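(* There exist constants $c>1$ and $\Delta_0$ such that for all integers $\Delta\geq\Delta_0$, $n\geq \Delta$ and $H\geq 2$ there exists a graded digraph $G$ with maximum degree $\Delta$ and with a graded partition $V(G)=V_1\cup\dots\cup V_H$ such that $|V_i|\leq n$ for all $i\in[H]$, and such that $\vec r(G) > c^\Delta H n \geq c^\Delta |V(G)|$.
   Context: A digraph $G$ is graded with graded partition $V(G)=V_1\cup\dots\cup V_H$ if every edge of $G$ is directed from $V_i$ to $V_{i+1}$ for some $i\in[H-1]$. The maximum degree of a digraph is the maximum degree of its underlying undirected graph. A tournament is an orientation of a complete graph; for an acyclic digraph $G$, $\vec r(G)$ is the smallest $N$ such that every tournament on $N$ vertices contains a copy of $G$. *)

(* Defs.v *)
From mathcomp Require Import all_boot.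

Set Implicit Arguments.
Unset Strict Implicit.
Unset Printing Implicit Defensive.

(** A digraph on a finite vertex type [V] is its edge relation [e : rel V]:
    [e x y] says that there is an edge directed from [x] to [y]. *)

Definition underlying (V : finType) (e : rel V) : rel V :=
  fun x y => (x != y) && (e x y || e y x).

Definition max_degree (V : finType) (e : rel V) : nat :=
  \max_(x : V) #|[set y | underlying e x y]|.

(** The parts are indexed from [0] to [H - 1]. Since [partition] speaks about a
    set of blocks, injectivity is needed to say that the [H] blocks are distinct;
    [partition] also requires them to be nonempty. *)
Definition graded_partition (V : finType) (e : rel V) (H : nat)
    (P : 'I_H -> {set V}) : Prop :=
  [/\ injective P,
      partition [set P i | i : 'I_H] [set: V]
    & forall x y : V, e x y ->
        exists i j : 'I_H, [/\ nat_of_ord j = i.+1, x \in P i & y \in P j]].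

Definition tournament (T : finType) (t : rel T) : Prop :=
  irreflexive t /\ forall x y : T, x != y -> t x y = ~~ t y x.

(** Copies are not required to be induced. *)
Definition contains_copy (V T : finType) (e : rel V) (t : rel T) : Prop :=
  exists f : V -> T, injective f /\ forall x y : V, e x y -> t (f x) (f y).

Definition tournament_unavoidable (V : finType) (e : rel V) (N : nat) : Prop :=
  forall t : rel 'I_N, tournament t -> contains_copy e t.

(** [oriented_ramsey e r] says that the oriented Ramsey number of [e] exists
    and is equal to [r]. *)
Definition oriented_ramsey (V : finType) (e : rel V) (r : nat) : Prop :=
  tournament_unavoidable e r /\
  forall N : nat, tournament_unavoidable e N -> r <= N.

(* Main.v *)
Require Import Defs.
From mathcomp Require Import all_boot all_order all_algebra.
From mathcomp Require Import perm fingroup.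
From mathcomp Require Import boolp reals.
From mathcomp Require Import zify lra.
Import Order.TTheory GRing.Theory Num.Theory.

Set Implicit Arguments.
Unset Strict Implicit.
Unset Printing Implicit Defensive.

(** Put the same bipartite graph [F] on ['I_n + 'I_n], a union of [O(Delta)]
    random perfect matchings, between any two consecutive layers. The avoiding
    tournament consists of [H / 2] blocks in transitive order, each block being
    a blow-up, with parts of size [s = Theta(n / Delta)], of a random tournament
    on [2 ^ h] vertices with [h = Theta(Delta)].

    As [F] is an expander, the blocks met by the bulk of the layers increase
    along the layers, so two consecutive layers put almost all their vertices in
    the same block. There the two sets of vertices are spread over the parts,
    hence a constant proportion of the pairs of vertices lie in parts joined by
    an edge of the wrong direction. Each perfect matching avoids a fixed such set
    of pairs with probability [exp (- Omega n)], so [F] avoids it with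
    probability [exp (- Omega (Delta n))], while only [2 ^ O(h n)] sets of pairs
    arise; therefore some [F] meets them all. *)

Local Open Scope nat_scope.

(** * Random permutations meeting dense sets of pairs *)

Lemma leq_exp_base (m n e : nat) : m <= n -> m ^ e <= n ^ e.
Proof. by case: (posnP e) => [-> // | e0]; rewrite leq_exp2r. Qed.

Lemma union_bound (T I : finType) (bad : I -> {set T}) :
  \sum_i #|bad i| < #|T| -> exists x, forall i, x \notin bad i.
Proof.
move=> lt_bad; have /existsP[x xU] : [exists x, x \notin \bigcup_i bad i].
  apply: contraTT lt_bad; rewrite negb_exists -leqNgt => /forallP all_bad.
  apply: (@leq_trans #|\bigcup_i bad i|).
    by apply/subset_leq_card/subsetP => x _; have := all_bad x; rewrite negbK.
  elim/big_rec2: _ => [|i a U _ leU]; first by rewrite cards0.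
  by apply: leq_trans (leq_card_setU _ _) _; rewrite leq_add2l.
exists x => i; apply: contra xU => xi; by apply/bigcupP; exists i.
Qed.

Lemma leq_card_fibres (T U : finType) (f : T -> U) (S : {set T}) a b :
    #|f @: S| <= a -> (forall y, #|[set x in S | f x == y]| <= b) ->
  #|S| <= a * b.
Proof.
move=> leA leB; rewrite -sum1_card (partition_big_imset f) /=.
apply: leq_trans (leq_mul leA (leqnn b)).
rewrite -sum_nat_const; apply: leq_sum => y _.
by apply: leq_trans (leB y); rewrite -sum1_card; under [X in _ <= X]eq_bigl do rewrite inE.
Qed.

Lemma leq_card_family (X Y : finType) (F : X -> {set Y}) (X0 : {set X}) c b :
    (forall x, x \in X0 -> #|F x| <= c) -> (forall x, x \notin X0 -> #|F x| <= b) ->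
  #|[set f : {ffun X -> Y} | [forall x, f x \in F x]]| <= c ^ #|X0| * b ^ #|~: X0|.
Proof.
move=> leC leB; have -> : #|[set f : {ffun X -> Y} | [forall x, f x \in F x]]|
    = #|family (fun x => [pred y in F x])|.
  by apply: eq_card => f; rewrite inE; apply/forallP/familyP.
rewrite card_family foldrE big_map big_enum /= (bigID (mem X0)) /=.
rewrite -!prod_nat_const; apply: leq_mul.
  exact: (leq_prod leC).
apply: (@leq_trans (\prod_(i | i \notin X0) b)); last first.
  by apply/eq_leq/eq_bigl => x; rewrite inE.
exact: (leq_prod leB).
Qed.

(* A permutation is determined by its values on [X0] up to a permutation
   supported on the complement of [X0]. *)
Lemma card_perm_rows (n c : nat) (C : 'I_n -> {set 'I_n}) (X0 : {set 'I_n}) :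
    (forall x, x \in X0 -> #|C x| <= c) ->
  #|[set p : {perm 'I_n} | [forall x in X0, p x \in C x]]|
    <= c ^ #|X0| * (n - #|X0|)`!.
Proof.
move=> leC; pose r (p : {perm 'I_n}) := [ffun x => if x \in X0 then p x else x].
apply: (leq_card_fibres (f := r)) => [|y].
  pose F x := if x \in X0 then C x else [set x].
  have := @leq_card_family _ _ F X0 c 1; rewrite exp1n muln1 => leF.
  apply: leq_trans (leF _ _); rewrite /F.
  - apply/subset_leq_card/subsetP => _ /imsetP[p pS ->].
    move: pS; rewrite inE => /forall_inP pC.
    rewrite inE; apply/forallP => x; rewrite ffunE.
    by case: ifP => [/pC // | _]; rewrite inE.
  - by move=> x xX; rewrite xX leC.
  - by move=> x /negPf ->; rewrite cards1.
set S := finset _; case: (set_0Vmem S) => [-> | [p0 p0S]]; first by rewrite cards0.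
have -> : n - #|X0| = #|~: X0| by rewrite [RHS]cardsCs setCK card_ord.
rewrite -card_perm -(card_imset _ (mulIg p0^-1)%g).
apply/subset_leq_card/subsetP => _ /imsetP[p pS ->].
apply/subsetP => x; rewrite !inE; apply: contra => xX.
move: pS p0S; rewrite !inE => /andP[_ /eqP/ffunP/(_ x) py] /andP[_ /eqP/ffunP/(_ x)].
by rewrite -py !ffunE xX permM => <-; rewrite permK.
Qed.

(** The falling factorial [n ^_ u] has [u] factors, each at least [n - u]. *)
Lemma ffact_ge (n u : nat) : (n - u) ^ u * (n - u)`! <= n`!.
Proof.
case: (leqP u n) => [le_un | /ltnW lt_nu].
  rewrite -(ffact_fact le_un) leq_mul2r; apply/orP; right.
  elim: u le_un => [|u IHu] // lt_un.
  rewrite ffactnSr expnSr; apply: leq_mul; last lia.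
  apply: leq_trans (IHu (ltnW lt_un)).
  by apply: leq_exp_base; lia.
have -> : n - u = 0 by lia.
rewrite fact0 muln1 (leq_trans _ (fact_gt0 n)) //.
by case: u lt_nu => // u _; rewrite exp0n.
Qed.

(** Bernoulli's inequality for [(1 + 1/a) ^ a.+1], cleared of denominators. At [a = 127] it turns
    128 factors [127/128] into a factor [1/2]. *)
Lemma bernoulli_halving (a : nat) : 2 * a ^ a.+1 <= a.+1 ^ a.+1.
Proof.
case: a => [|a] //; set b := a.+1.
have bern m : b ^ m * (b + m) <= b.+1 ^ m * b.
  elim: m => [|m IHm]; first by rewrite !mul1n addn0.
  apply: (@leq_trans (b ^ m * (b + m) * b.+1)).
    by rewrite expnS; move: (b ^ m) => x; nia.
  by rewrite [b.+1 ^ _]expnS -[leqRHS]mulnA [leqRHS]mulnC leq_mul2r IHm orbT.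
rewrite -(@leq_pmul2r b) //; apply: leq_trans (bern b.+1).
by rewrite mulnAC mulnC leq_mul2l; apply/orP; right; lia.
Qed.

(** The factor 2 outweighs the at most [u] entries of a row that an injective map may already have
    used on the other chosen rows. *)
Definition many_full_rows (X Y : finType) (u : nat) (D : X -> Y -> bool) :=
  exists X0 : {set X}, #|X0| = u /\ forall x, x \in X0 -> 2 * u <= #|[set y | D x y]|.

(** An avoiding permutation has at most [n - 2 * u] choices on each of the [u] full rows, against at
    least [n - u] for a general one. The ratio is at most [127/128] because [n <= 128 * u]. *)
Lemma card_perm_avoid (n u : nat) (D : rel 'I_n) :
    n <= 128 * u -> many_full_rows u D ->
  128 ^ u * #|[set p : {perm 'I_n} | [forall x, ~~ D x (p x)]]| <= 127 ^ u * n`!.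
Proof.
move=> n_le [X0 [cX0 rows]].
have leP : #|[set p : {perm 'I_n} | [forall x, ~~ D x (p x)]]|
    <= (n - 2 * u) ^ u * (n - u)`!.
  rewrite -cX0; apply: leq_trans (card_perm_rows (C := fun x => [set y | ~~ D x y]) _).
    apply/subset_leq_card/subsetP => p; rewrite !inE => /forallP pD.
    by apply/forall_inP => x _; rewrite inE.
  move=> x /rows le2; rewrite cX0.
  have := cardsC [set y | D x y]; rewrite card_ord.
  have -> : ~: [set y | D x y] = [set y | ~~ D x y] by apply/setP => y; rewrite !inE.
  by move: le2; set a := #|_|; set b := #|_|; lia.
apply: leq_trans (leq_mul (leqnn _) leP) _; rewrite mulnA -expnMn.
apply: (@leq_trans ((127 * (n - u)) ^ u * (n - u)`!)).
  rewrite leq_mul2r; apply/orP; right.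
  by apply: leq_exp_base; lia.
by rewrite expnMn -mulnA leq_mul2l ffact_ge orbT.
Qed.

Lemma card_perm_avoid_tr (n u : nat) (D : rel 'I_n) :
    n <= 128 * u -> many_full_rows u (fun y x => D x y) ->
  128 ^ u * #|[set p : {perm 'I_n} | [forall x, ~~ D x (p x)]]| <= 127 ^ u * n`!.
Proof.
move=> n_le rows; apply: leq_trans (card_perm_avoid n_le rows).
rewrite leq_mul2l; apply/orP; right.
rewrite -(card_imset _ (@invg_inj {perm 'I_n})).
apply/subset_leq_card/subsetP => _ /imsetP[p pD ->].
rewrite inE; apply/forallP => y.
by move: pD; rewrite inE => /forallP/(_ ((p^-1)%g y)); rewrite permKV.
Qed.

(** Union bound over [I]: independent uniform permutations, [128 * e] in number, all avoid a given
    [D i] with probability at most [(127/128) ^ (128 * u * e) <= 2 ^ - (u * e)]. *)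
Lemma exists_hitting_perms (n u e : nat) (I : finType) (D : I -> rel 'I_n) :
    0 < u -> n <= 128 * u -> #|I| < 2 ^ (u * e) ->
  exists p : 'I_(128 * e) -> {perm 'I_n}, forall i,
    many_full_rows u (D i) \/ many_full_rows u (fun y x => D i x y) ->
    exists j x, D i x (p j x).
Proof.
move=> u0 n_le cardI; set d := 128 * e.
pose A i := [set p : {perm 'I_n} | [forall x, ~~ D i x (p x)]].
(* This boolean inequality follows from either row condition and replaces them in the union bound;
   the other indices get an empty bad event. *)
pose small i := 128 ^ u * #|A i| <= 127 ^ u * n`!.
pose bad (i : I) := if small i
  then [set p : {ffun 'I_d -> {perm 'I_n}} | [forall j, p j \in A i]]
  else set0.
case: (@union_bound _ _ bad) => [|p goodp].
  have le_bad i : 128 ^ (u * d) * #|bad i| <= 127 ^ (u * d) * n`! ^ d.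
    rewrite /bad; case: ifP => [small_i | _]; last by rewrite cards0 muln0.
    have leA' : #|[set p : {ffun 'I_d -> {perm 'I_n}} | [forall j, p j \in A i]]| <= #|A i| ^ d.
      have := @leq_card_family _ _ (fun _ : 'I_d => A i) setT #|A i| 1.
      by rewrite cardsT card_ord exp1n muln1; apply => // x; rewrite inE.
    apply: leq_trans (leq_mul (leqnn _) leA') _.
    by rewrite !(expnM _ u d) -!expnMn; exact: (leq_exp_base d small_i).
  have cardT : #|{: {ffun 'I_d -> {perm 'I_n}}}| = n`! ^ d by rewrite card_ffun card_Sn card_ord.
  rewrite cardT -(@ltn_pmul2l (128 ^ (u * d))) ?expn_gt0 // big_distrr /=.
  apply: (@leq_ltn_trans (\sum_(i : I) 127 ^ (u * d) * n`! ^ d)); first exact: leq_sum.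
  rewrite sum_nat_const mulnA ltn_pmul2r ?expn_gt0 ?fact_gt0 //.
  apply: (@leq_trans (2 ^ (u * e) * 127 ^ (u * d))).
    by rewrite ltn_pmul2r ?expn_gt0.
  have -> : u * d = 128 * (u * e) by rewrite /d; lia.
  rewrite !(expnM _ 128) -expnMn; have := bernoulli_halving 127.
  by apply: leq_exp_base.
exists p => i rows; have small_i : small i.
  by case: rows => rows; [apply: card_perm_avoid | apply: card_perm_avoid_tr].
have := goodp i; rewrite /bad small_i inE negb_forall => /existsP[j].
rewrite inE negb_forall => /existsP[x]; rewrite negbK => Dx; by exists j, x.
Qed.

(** * Random tournaments *)

Lemma prod_nat_if (T : finType) (A : {set T}) c :
  \prod_i (if i \in A then c else 1) = c ^ #|A|.
Proof. by rewrite -big_mkcond prod_nat_const. Qed.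

Definition small_trace (T : finType) (h : nat) (z : bool) (P : {set T}) :=
  [set S : {set T} | #|[set a in P | (a \in S) == z]| < h].

(* Exponential moment bound: weight [S] by 15 to the number of [a] in [P] not
   counted by [small_trace]. *)
Lemma card_small_trace (T : finType) (h : nat) (z : bool) (P : {set T}) :
  #|P| = 8 * h -> 2 ^ (3 * h) * #|small_trace h z P| <= 2 ^ #|T|.
Proof.
move=> cP; pose w (S : {set T}) := #|[set a in P | (a \in S) != z]|.
(* The sum factorizes over the elements of [T]: those of [P] contribute [15 + 1], the others
   [1 + 1]. *)
have sumE : \sum_(S : {set T}) 15 ^ w S = 16 ^ #|P| * 2 ^ #|~: P|.
  pose F (y : bool) a := if (a \in P) && (y != z) then 15 else 1.
  transitivity (\prod_a (F true a + F false a)).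
    rewrite bigA_distr /=; apply: eq_bigr => S _.
    rewrite -prod_nat_if; apply: eq_bigr => a _.
    by rewrite inE /F; case: (a \in S).
  rewrite -!prod_nat_if -big_split /=; apply: eq_bigr => a _.
  by rewrite inE /F; case: (a \in P); case: (z).
have w_ge S : S \in small_trace h z P -> 7 * h <= w S.
  rewrite inE => small; have : #|[set a in P | (a \in S) == z]| + w S = #|P|.
    rewrite /w -[RHS](cardsID [set a | (a \in S) == z]); congr (_ + _);
      by apply: eq_card => a; rewrite !inE // andbC.
  by move: small; rewrite cP; set a := #|_|; lia.
have le15 : 15 ^ (7 * h) * #|small_trace h z P| <= 16 ^ #|P| * 2 ^ #|~: P|.
  rewrite -sumE mulnC -sum_nat_const [leqRHS](bigID (mem (small_trace h z P))) /=.
  apply: leq_trans (leq_addr _ _); apply: leq_sum => S /w_ge leS.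
  by rewrite leq_exp2l.
have cC : #|~: P| + 8 * h = #|T| by rewrite -cP addnC cardsC.
(* What remains is [2 ^ 27 <= 15 ^ 7] and [16 ^ 8 = 2 ^ 24 * 2 ^ 8], raised to the power [h]. *)
rewrite -(@leq_pmul2l (2 ^ (24 * h))) ?expn_gt0 // mulnA -expnD -cC.
apply: leq_trans (leq_trans _ le15) _.
  rewrite leq_mul2r; apply/orP; right.
  have -> : 24 * h + 3 * h = 27 * h by lia.
  by rewrite !expnM; apply: leq_exp_base; lia.
rewrite cP [2 ^ (_ + _)]expnD mulnCA mulnC leq_mul2l; apply/orP; right.
by rewrite !expnM -expnMn; apply: leq_exp_base; lia.
Qed.

(** For independent uniform sets [M b], a fixed triple [(z, P, Q)] fails with probability at most
    [2 ^ - (3 * h * (8 * h))], by [card_small_trace] for each [b] in [Q]. There are at most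
    [2 * 2 ^ (16 * h * h)] triples, so some [M] serves them all. *)
Lemma exists_unbiased_family (h : nat) : 0 < h ->
  exists M : 'I_(2 ^ h) -> {set 'I_(2 ^ h)},
    forall (z : bool) (P Q : {set 'I_(2 ^ h)}), #|P| = 8 * h -> #|Q| = 8 * h ->
    exists2 b, b \in Q & h <= #|[set a in P | (a \in M b) == z]|.
Proof.
move=> h0; set K := 2 ^ h; set l := 8 * h.
(* Sets of size [l] are indexed redundantly by tuples, which are easy to count; [ok] discards tuples
   with repetitions. *)
pose I := (l.-tuple 'I_K * l.-tuple 'I_K * bool)%type.
pose sm (i : I) b := if b \in [set x in i.1.2]
  then small_trace h i.2 [set x in i.1.1] else setT.
pose ok (i : I) := (#|[set x in i.1.1]| == l) && (#|[set x in i.1.2]| == l).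
pose bad (i : I) := if ok i
  then [set M : {ffun 'I_K -> {set 'I_K}} | [forall b, M b \in sm i b]] else set0.
case: (@union_bound _ _ bad) => [|M goodM]; last first.
  exists M => z P Q cP cQ.
  have sP : size (enum P) == l by rewrite -cardE cP.
  have sQ : size (enum Q) == l by rewrite -cardE cQ.
  have eP : [set x in Tuple sP] = P by apply/setP => x; rewrite inE mem_enum.
  have eQ : [set x in Tuple sQ] = Q by apply/setP => x; rewrite inE mem_enum.
  have := goodM (Tuple sP, Tuple sQ, z).
  rewrite /bad /ok /= eP eQ cP cQ eqxx inE negb_forall /sm /= eP eQ => /existsP[b].
  by case: ifP => bQ; rewrite inE // -leqNgt => le_h; exists b.
have card_sets : #|{set 'I_K}| = 2 ^ K.
  by rewrite -cardsT -powersetT card_powerset cardsT card_ord.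
have card_bad i : 2 ^ (3 * h * l) * #|bad i| <= (2 ^ K) ^ K.
  rewrite /bad; case: ifP => [/andP[/eqP cP /eqP cQ] | _]; last by rewrite cards0 muln0.
  set Q := [set x in i.1.2] in cQ; set P := [set x in i.1.1] in cP.
  have := @leq_card_family _ _ (sm i) Q #|small_trace h i.2 P| (2 ^ K).
  move=> /(_ _ _)/(leq_mul (leqnn (2 ^ (3 * h * l)))) leB.
  apply: leq_trans (leB _ _) _ => [b bQ | b bQ |].
  - by rewrite /sm -/Q bQ.
  - by rewrite /sm -/Q (negPf bQ) cardsT card_sets.
  have cK : l + #|~: Q| = K by rewrite -cQ cardsC card_ord.
  have -> : (2 ^ K) ^ K = (2 ^ K) ^ l * (2 ^ K) ^ #|~: Q| by rewrite -expnD cK.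
  rewrite mulnA expnM cQ -expnMn.
  apply: leq_mul => //; apply: leq_exp_base.
  by apply: leq_trans (card_small_trace _ _) _; rewrite ?card_ord.
rewrite -(@ltn_pmul2l (2 ^ (3 * h * l))) ?expn_gt0 // big_distrr /=.
apply: (@leq_ltn_trans (\sum_(i : I) (2 ^ K) ^ K)); first exact: leq_sum.
rewrite sum_nat_const card_ffun card_ord card_sets ltn_pmul2r ?expn_gt0 //.
rewrite !card_prod !card_tuple card_bool card_ord -!expnM -expnD -expnSr ltn_exp2l //.
by rewrite /l; nia.
Qed.

(** A uniformly random [M] gives a uniformly random tournament; [M j] decides the pairs in which [j]
    is the larger vertex. *)
Definition upper_tournament (K : nat) (M : 'I_K -> {set 'I_K}) : rel 'I_K :=
  fun i j => (i < j) && (i \in M j) || (j < i) && (j \notin M i).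

Lemma tournament_upper (K : nat) (M : 'I_K -> {set 'I_K}) :
  tournament (upper_tournament M).
Proof.
split=> [i | i j]; rewrite /upper_tournament; first by rewrite ltnn.
by rewrite -val_eqE /=; case: ltngtP => //= _ _; rewrite ?orbF ?negbK.
Qed.

(** The blow-up of [s] in which every vertex is replaced by a copy of [t]. *)
Definition lex (S T : finType) (s : rel S) (t : rel T) : rel (S * T) :=
  fun x y => s x.1 y.1 || (x.1 == y.1) && t x.2 y.2.

Lemma tournament_lex (S T : finType) (s : rel S) (t : rel T) :
  tournament s -> tournament t -> tournament (lex s t).
Proof.
move=> [s_irr s_tot] [t_irr t_tot]; split=> [x | [x1 x2] [y1 y2]].
  by rewrite /lex s_irr eqxx t_irr.
rewrite /lex /= xpair_eqE; case: (eqVneq x1 y1) => [-> /= neq2 | neq1 _].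
  by rewrite s_irr /= t_tot.
by rewrite /= !orbF s_tot.
Qed.

Lemma tournament_ltn (m : nat) : tournament (fun i j : 'I_m => i < j).
Proof.
split=> [i | i j]; first exact: ltnn.
by rewrite -val_eqE /=; case: ltngtP.
Qed.

(** * Pairs of sets spread over a blow-up *)

Lemma exists_subset_card (T : finType) (A : {set T}) k :
  k <= #|A| -> exists2 B : {set T}, B \subset A & #|B| = k.
Proof.
move=> le_k; exists [set x in take k (enum A)].
  by apply/subsetP => x; rewrite inE => /mem_take; rewrite mem_enum.
rewrite cardsE (card_uniqP _) ?take_uniq ?enum_uniq // size_takel //.
by rewrite -cardE.
Qed.

Lemma card_sep_sum (T : finType) (A : {set T}) (p : pred T) :
  #|[set x in A | p x]| = \sum_(x in A) p x.
Proof.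
rewrite -sum1dep_card big_mkcondr /=; apply: eq_bigr => x _.
by case: (p x).
Qed.

(** Double counting. If more than [s * (8 * h)] elements of [A] had fewer than [c] bad partners,
    their images would contain a set [P] of [8 * h] values, with fewer than [8 * h * c] bad pairs
    between [P] and [B]. But all except [s * (8 * h)] elements of [B] are bad with at least [h]
    values of [P], which gives at least [h * (8 * c)] such pairs. *)
Lemma full_rows_from_unbiased (X Y : finType) (K h s c : nat)
    (f : X -> 'I_K) (g : Y -> 'I_K) (A : {set X}) (B : {set Y}) (bad : rel 'I_K) :
    0 < h ->
    (forall a, #|[set x in A | f x == a]| <= s) ->
    (forall b, #|[set y in B | g y == b]| <= s) ->
    (forall P Q : {set 'I_K}, P \subset f @: A -> Q \subset g @: B ->
       #|P| = 8 * h -> #|Q| = 8 * h ->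
       exists2 b, b \in Q & h <= #|[set a in P | bad a b]|) ->
    s * (8 * h) + 8 * c <= #|B| ->
  #|A| <= s * (8 * h) + #|[set x in A | c <= #|[set y in B | bad (f x) (g y)]|]|.
Proof.
move=> h0 fib_f fib_g unbiased leB.
have fibres (Z : finType) (F : Z -> 'I_K) (C D : {set Z}) :
    (forall a, #|[set z in C | F z == a]| <= s) -> D \subset C ->
    #|F @: D| <= 8 * h -> #|D| <= s * (8 * h).
  move=> fib sDC leD; rewrite mulnC; apply: (leq_card_fibres leD) => a.
  apply: leq_trans (fib a); apply/subset_leq_card/subsetP => z.
  by rewrite !inE => /andP[/(subsetP sDC) -> ->].
pose w a := #|[set y in B | bad a (g y)]|.
pose A0 := [set x in A | w (f x) < c].
have -> : #|A| = #|A0| + #|[set x in A | c <= w (f x)]|.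
  rewrite -(cardsID [set x | w (f x) < c] A); congr (_ + _); apply: eq_card => x;
    by rewrite !inE -?leqNgt // andbC.
rewrite leq_add2r; have sA0 : A0 \subset A by apply/subsetP => x; rewrite inE => /andP[].
apply: (fibres _ f A) => //; rewrite leqNgt; apply/negP => /ltnW.
case/exists_subset_card => P sP cP.
have sum_small : \sum_(a in P) w a + 8 * h <= 8 * h * c.
  rewrite -cP -sum1_card -big_split /= [leqRHS]mulnC big_distrr /=.
  apply: leq_sum => a /(subsetP sP)/imsetP[x]; rewrite inE => /andP[_ lt_c] ->.
  by rewrite addn1 muln1.
pose v b := #|[set a in P | bad a b]|.
have sumE : \sum_(a in P) w a = \sum_(y in B) v (g y).
  under eq_bigr do rewrite /w card_sep_sum; rewrite exchange_big /=.
  by apply: eq_bigr => y _; rewrite /v card_sep_sum.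
(* If [B0] were large, its images would contain a set [Q] contradicting the hypothesis for [P] and
   [Q]. *)
pose B0 := [set y in B | v (g y) < h].
have sB0 : B0 \subset B by apply/subsetP => y; rewrite inE => /andP[].
have leB0 : #|B0| <= s * (8 * h).
  apply: (fibres _ g B) => //; rewrite leqNgt; apply/negP => /ltnW.
  case/exists_subset_card => Q sQ cQ.
  have [||b bQ] := unbiased P Q _ _ cP cQ.
  - by apply: subset_trans sP _; apply: imsetS.
  - by apply: subset_trans sQ _; apply: imsetS.
  have /imsetP[y] := subsetP sQ b bQ; rewrite inE => /andP[_ lt_h] ->.
  by rewrite leqNgt lt_h.
have sum_large : h * #|B :\: B0| <= \sum_(y in B) v (g y).
  rewrite mulnC -sum_nat_const [leqRHS](big_setID B0) /=.
  apply: leq_trans (leq_addl _ _); apply: leq_sum => y.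
  by rewrite !inE => /andP[+ yB]; rewrite yB /= -leqNgt.
have := cardsID B0 B; rewrite (setIidPr sB0) => cB.
have : h * (8 * c) <= h * #|B :\: B0| by rewrite leq_mul2l; apply/orP; right; lia.
by rewrite sumE in sum_small; lia.
Qed.

(** Cut at the median [t] of [f] on [A]. At least half of [B] lies on one side of [t], and the
    opposite side contains half of [A] up to one fibre. In [upper_tournament] all remaining pairs
    are then decided by membership in [M] of the same side. *)
Lemma threshold_split (X Y : finType) (s : nat) (f : X -> nat) (g : Y -> nat)
    (A : {set X}) (B : {set Y}) :
    (forall a, #|[set x in A | f x == a]| <= s) ->
  exists (A' : {set X}) (B' : {set Y}),
    [/\ A' \subset A, B' \subset B, #|A| <= 2 * #|A'| + 2 * s, #|B| <= 2 * #|B'|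
      & (forall x y, x \in A' -> y \in B' -> f x < g y)
        \/ (forall x y, x \in A' -> y \in B' -> g y < f x)].
Proof.
move=> fib; pose below t := [set x in A | f x < t].
have ex_t : exists t, #|A| <= 2 * #|below t|.
  exists (\max_x f x).+1; have -> : below (\max_x f x).+1 = A; last lia.
  by apply/setP => x; rewrite inE ltnS leq_bigmax andbT.
case: (ex_minnP ex_t) => t le_t min_t.
have split_A : #|below t| + #|[set x in A | t <= f x]| = #|A|.
  rewrite -[RHS](cardsID [set x | f x < t]); congr (_ + _); apply: eq_card => x;
    by rewrite !inE -?leqNgt // andbC.
have split_B : #|[set y in B | g y < t]| + #|[set y in B | t <= g y]| = #|B|.
  rewrite -[RHS](cardsID [set y | g y < t]); congr (_ + _); apply: eq_card => y;
    by rewrite !inE -?leqNgt // andbC.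
have le_below : 2 * #|below t| <= #|A| + 2 * s.
  case: t le_t min_t {split_A split_B} => [|t] _ min_t.
    rewrite /below (_ : [set x in A | _] = set0) ?cards0 //.
    by apply/setP => x; rewrite !inE ltn0 andbF.
  have lt_t : 2 * #|below t| < #|A| by rewrite ltnNge; apply/negP => /min_t; rewrite ltnn.
  have : #|below t.+1| <= #|below t| + #|[set x in A | f x == t]|.
    apply: leq_trans (leq_card_setU _ _); apply/subset_leq_card/subsetP => x.
    by rewrite !inE ltnS leq_eqVlt => /andP[-> /orP[]->]; rewrite ?orbT.
  by have := fib t; lia.
have sub (Z : finType) (C : {set Z}) p : [set z in C | p z] \subset C.
  by apply/subsetP => z; rewrite inE => /andP[].
case: (leqP #|B| (2 * #|[set y in B | t <= g y]|)) => [leB | ltB].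
  exists (below t), [set y in B | t <= g y]; split; rewrite ?sub //; first lia.
  by left => x y; rewrite !inE => /andP[_ lt_ft] /andP[_]; apply: leq_trans.
exists [set x in A | t <= f x], [set y in B | g y < t]; split; rewrite ?sub //; try lia.
by right => x y; rewrite !inE => /andP[_ le_tf] /andP[_ lt_gt]; apply: leq_trans le_tf.
Qed.

(** An edge from [x] to [y] at such a pair would be mapped against the orientation of [R]. *)
Definition bad_pairs (X Y : finType) (K : nat) (R : rel 'I_K)
    (A : {set X}) (B : {set Y}) (f : X -> 'I_K) (g : Y -> 'I_K) (x : X) (y : Y) :=
  [&& x \in A, y \in B & R (g y) (f x)].

Lemma many_full_rowsI (X Y : finType) (u : nat) (D : X -> Y -> bool) (A : {set X}) :
    u <= #|[set x in A | 2 * u <= #|[set y | D x y]|]| -> many_full_rows u D.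
Proof.
case/exists_subset_card => X0 sX0 cX0; exists X0; split=> // x /(subsetP sX0).
by rewrite inE => /andP[].
Qed.

(** After [threshold_split] the sets still have at least [29 * u] elements. If [f] lies below [g], a
    pair is bad when [f x \notin M (g y)], and counting gives full rows; otherwise it is bad when
    [g y \in M (f x)], and the exchanged roles give full columns. *)
Lemma bad_pairs_full (X Y : finType) (h s u : nat) (M : 'I_(2 ^ h) -> {set 'I_(2 ^ h)})
    (f : X -> 'I_(2 ^ h)) (g : Y -> 'I_(2 ^ h)) (A : {set X}) (B : {set Y}) :
    0 < h ->
    (forall (z : bool) (P Q : {set 'I_(2 ^ h)}), #|P| = 8 * h -> #|Q| = 8 * h ->
       exists2 b, b \in Q & h <= #|[set a in P | (a \in M b) == z]|) ->
    (forall a, #|[set x in A | f x == a]| <= s) ->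
    (forall b, #|[set y in B | g y == b]| <= s) ->
    s * (8 * h) <= u -> 60 * u <= #|A| -> 60 * u <= #|B| ->
  exists (A' : {set X}) (B' : {set Y}), [/\ A' \subset A, B' \subset B &
    let D := bad_pairs (upper_tournament M) A' B' f g in
    many_full_rows u D \/ many_full_rows u (fun y x => D x y)].
Proof.
set K := 2 ^ h => h0 unbiased fib_f fib_g le_s leA leB.
have fib_nat a : #|[set x in A | f x == a :> nat]| <= s.
  case: (ltnP a K) => [lt_a | ge_a].
    by apply: leq_trans (fib_f (Ordinal lt_a)).
  rewrite (_ : [set x in A | _] = set0) ?cards0 //; apply/setP => x.
  rewrite !inE; apply/negbTE; rewrite negb_and; apply/orP; right.
  by have := ltn_ord (f x); lia.
have [A' [B' [sA sB leA' leB' sep]]] := 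
  threshold_split (fun y => nat_of_ord (g y)) B fib_nat.
have s_le : s <= u by nia.
have fibA a : #|[set x in A' | f x == a]| <= s.
  apply: leq_trans (fib_f a); apply/subset_leq_card/subsetP => x.
  by rewrite !inE => /andP[/(subsetP sA) -> ->].
have fibB b : #|[set y in B' | g y == b]| <= s.
  apply: leq_trans (fib_g b); apply/subset_leq_card/subsetP => y.
  by rewrite !inE => /andP[/(subsetP sB) -> ->].
exists A', B'; split=> //=; rewrite /bad_pairs.
case: sep => sep; [left | right].
  have leR : #|A'| <= s * (8 * h)
      + #|[set x in A' | 2 * u <= #|[set y in B' | upper_tournament M (g y) (f x)]|]|.
    apply: (full_rows_from_unbiased (bad := fun a b => upper_tournament M b a) h0 fibA fibB)
      => [P Q /subsetP sP /subsetP sQ cP cQ |]; last lia.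
    have [b bQ le_h] := unbiased false P Q cP cQ; exists b => //.
    apply: leq_trans le_h _; apply/subset_leq_card/subsetP => a.
    rewrite !inE => /andP[aP]; rewrite aP /upper_tournament /=.
    have /imsetP[x xA ->] := sP a aP; have /imsetP[y yB ->] := sQ b bQ.
    by rewrite (sep x y xA yB) orbC => /eqP ->.
  apply: (many_full_rowsI (A := A')).
  apply: leq_trans (_ : #|[set x in A' | 2 * u <=
      #|[set y in B' | upper_tournament M (g y) (f x)]|]| <= _).
    by move: leR; set r := #|[set x in A' | _]|; lia.
  apply/subset_leq_card/subsetP => x; rewrite !inE => /andP[xA le2]; rewrite xA.
  apply: leq_trans le2 _; apply/subset_leq_card/subsetP => y.
  by rewrite !inE.
have leR : #|B'| <= s * (8 * h)
    + #|[set y in B' | 2 * u <= #|[set x in A' | upper_tournament M (g y) (f x)]|]|.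
  apply: (full_rows_from_unbiased (bad := fun b a => upper_tournament M b a) h0 fibB fibA)
    => [P Q /subsetP sP /subsetP sQ cP cQ |]; last lia.
  have [a aQ le_h] := unbiased true P Q cP cQ; exists a => //.
  apply: leq_trans le_h _; apply/subset_leq_card/subsetP => b.
  rewrite !inE => /andP[bP]; rewrite bP /upper_tournament /=.
  have /imsetP[y yB ->] := sP b bP; have /imsetP[x xA ->] := sQ a aQ.
  by rewrite (sep x y xA yB) => /eqP ->.
apply: (many_full_rowsI (A := B')).
apply: leq_trans (_ : #|[set y in B' | 2 * u <=
    #|[set x in A' | upper_tournament M (g y) (f x)]|]| <= _).
  by move: leR; set r := #|[set y in B' | _]|; lia.
apply/subset_leq_card/subsetP => y; rewrite !inE => /andP[yB le2]; rewrite yB.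
apply: leq_trans le2 _; apply/subset_leq_card/subsetP => x.
by rewrite !inE => /andP[-> ->].
Qed.

(** * The avoiding tournament *)

(** [F] is the union of the graphs of [128 * (1024 * h)] permutations, which bounds both degrees,
    chosen to meet every relation [bad_pairs R A B f g] with full rows or columns. *)
Lemma exists_core (n h s u : nat) :
    0 < h -> 0 < u -> n <= 128 * u -> s * (8 * h) <= u ->
  exists (F : rel 'I_n) (R : rel 'I_(2 ^ h)),
    [/\ tournament R,
        forall x, #|[set y | F x y]| <= 128 * (1024 * h),
        forall y, #|[set x | F x y]| <= 128 * (1024 * h),
        forall A B : {set 'I_n}, 2 * u <= #|A| -> 2 * u <= #|B| ->
          exists x y, [/\ x \in A, y \in B & F x y]
      & forall (A B : {set 'I_n}) (f g : 'I_n -> 'I_(2 ^ h)),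
          (forall a, #|[set x in A | f x == a]| <= s) ->
          (forall b, #|[set y in B | g y == b]| <= s) ->
          60 * u <= #|A| -> 60 * u <= #|B| ->
          exists x y, [/\ x \in A, y \in B, F x y & R (g y) (f x)]].
Proof.
move=> h0 u0 n_le le_s; have [M unbiased] := exists_unbiased_family h0.
set K := 2 ^ h in M unbiased *; set R := upper_tournament M.
have K_gt1 : 1 < K by rewrite -{1}(expn0 2) ltn_exp2l.
have tR : tournament R by exact: tournament_upper.
pose I := ({set 'I_n} * {set 'I_n} * ({ffun 'I_n -> 'I_K} * {ffun 'I_n -> 'I_K}))%type.
pose D (i : I) := bad_pairs R i.1.1 i.1.2 i.2.1 i.2.2.
(* There are [2 ^ (2 * n + 2 * h * n)] quadruples, and the exponent is at most
   [4 * h * n <= 512 * u * h]. *)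
have [|p hit] := @exists_hitting_perms n u (1024 * h) I D u0 n_le.
  have card_sets : #|{set 'I_n}| = 2 ^ n.
    by rewrite -cardsT -powersetT card_powerset cardsT card_ord.
  rewrite !card_prod card_sets !card_ffun !card_ord /K -!expnM -!expnD ltn_exp2l //.
  have : n + n + (h * n + h * n) <= 4 * h * n by nia.
  have : 4 * h * n <= 512 * (u * h) by nia.
  have : 0 < u * h by rewrite muln_gt0 u0.
  by rewrite (mulnCA u); lia.
pose F x y := [exists j, p j x == y].
have hitF A B (f g : 'I_n -> 'I_K) :
    many_full_rows u (bad_pairs R A B f g)
      \/ many_full_rows u (fun y x => bad_pairs R A B f g x y) ->
    exists x y, [/\ x \in A, y \in B, F x y & R (g y) (f x)].
  move=> full; have DE x y : D (A, B, (finfun f, finfun g)) x y = bad_pairs R A B f g x y.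
    by rewrite /D /bad_pairs /= !ffunE.
  have [|j [x]] := hit (A, B, (finfun f, finfun g)).
    by case: full => -[X0 [cX0 rows]]; [left | right]; exists X0; split=> // x xX;
      apply: leq_trans (rows x xX) _; apply/subset_leq_card/subsetP => y; rewrite !inE DE.
  rewrite DE => /and3P[xA yB Rxy]; exists x, (p j x); split=> //.
  by apply/existsP; exists j.
exists F, R; split=> // [x | y | A B leA leB | A B f g fibA fibB leA leB].
- have -> : [set y | F x y] = [set p j x | j : 'I_(128 * (1024 * h))].
    apply/setP => y; rewrite inE; apply/existsP/imsetP => [[j /eqP <-] | [j _ ->]]; by exists j.
  by apply: leq_trans (leq_imset_card _ _) _; rewrite card_ord.
- have -> : [set x | F x y] = [set (p j)^-1%g y | j : 'I_(128 * (1024 * h))].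
    apply/setP => x; rewrite inE; apply/existsP/imsetP => [[j /eqP <-] | [j _ ->]].
      by exists j; rewrite // permK.
    by exists j; rewrite permKV.
  by apply: leq_trans (leq_imset_card _ _) _; rewrite card_ord.
(* Expansion is the case of constant [f] and [g] at the ends of an edge of [R], for which every pair
   in [A] times [B] is bad. *)
- have [a [b Rba]] : exists a b, R b a.
    pose i0 : 'I_K := Ordinal (ltnW K_gt1); pose i1 : 'I_K := Ordinal K_gt1.
    have := tR.2 i0 i1 isT; case R01: (R i0 i1); first by exists i1, i0.
    by move/esym/negbFE => R10; exists i0, i1.
  have [|x [y [xA yB Fxy _]]] := hitF A B (fun=> a) (fun=> b); last by exists x, y.
  left; apply: (many_full_rowsI (A := A)).
  apply: (@leq_trans #|A|); first lia.
  apply/subset_leq_card/subsetP => x xA; rewrite inE xA /=.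
  apply: leq_trans leB _; apply/subset_leq_card/subsetP => y yB.
  by rewrite inE /bad_pairs xA yB.
have [A' [B' [sA sB full]]] := bad_pairs_full h0 unbiased fibA fibB le_s leA leB.
have [x [y [xA yB Fxy Rgf]]] := hitF A' B' f g full.
by exists x, y; split=> //; [apply: (subsetP sA) | apply: (subsetP sB)].
Qed.

Lemma exists_quantile (n q : nat) (b : 'I_n -> nat) : 0 < q -> q <= n ->
  exists t, q <= #|[set x | b x <= t]| /\ #|[set x | b x < t]| < q.
Proof.
move=> q0 le_q; have ex_t : exists t, q <= #|[set x | b x <= t]|.
  exists (\max_x b x); have -> : [set x | b x <= \max_x b x] = setT.
    by apply/setP => x; rewrite !inE leq_bigmax.
  by rewrite cardsT card_ord.
case: (ex_minnP ex_t) => t le_t min_t; exists t; split=> //.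
case: t min_t {le_t} => [|t] min_t.
  by rewrite (_ : [set x | _] = set0) ?cards0 //; apply/setP => x; rewrite !inE.
by rewrite ltnNge; apply/negP => /min_t; rewrite ltnn.
Qed.

Lemma leq_card_imply (T : finType) (p q : pred T) :
  (forall x, p x -> q x) -> #|[set x | p x]| <= #|[set x | q x]|.
Proof. by move=> pq; apply/subset_leq_card/subsetP => x; rewrite !inE; apply: pq. Qed.

(* The [2u]-quantile of each layer lies above the [(n-2u)]-quantile of the
   previous one, so with fewer values than disjoint pairs of consecutive layers
   some pair has all four of its quantiles equal. *)
Lemma exists_concentrated_layers (H n m u : nat) (F : rel 'I_n) (b : nat -> 'I_n -> nat) :
    0 < u -> 4 * u <= n -> 0 < m -> 2 * m <= H ->
    (forall A B : {set 'I_n}, 2 * u <= #|A| -> 2 * u <= #|B| ->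
       exists x y, [/\ x \in A, y \in B & F x y]) ->
    (forall i x, i < H -> b i x < m) ->
    (forall i x y, i.+1 < H -> F x y -> b i x <= b i.+1 y) ->
  exists i t, [/\ i.+1 < H, n - 4 * u <= #|[set x | b i x == t]|
                & n - 4 * u <= #|[set x | b i.+1 x == t]|].
Proof.
move=> u0 u_le m0 m_le expand b_lt mono.
have ltC i v : #|[set x | b i x < v]| + #|[set x | v <= b i x]| = n.
  rewrite -[RHS]card_ord -(cardsC [set x | b i x < v]); congr (_ + _).
  by apply: eq_card => x; rewrite !inE -leqNgt.
have eqC i v : #|[set x | b i x <= v]| <= #|[set x | b i x < v]| + #|[set x | b i x == v]|.
  apply: leq_trans (leq_card_setU _ _); apply/subset_leq_card/subsetP => x.
  by rewrite !inE leq_eqVlt orbC.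
(* Expansion gives an edge of [F] from the top of layer [i] to the bottom of layer [i.+1], and [b]
   does not decrease along it. *)
have next i v l : i.+1 < H -> #|[set x | b i x < v]| < n - 2 * u ->
    2 * u <= #|[set x | b i.+1 x <= l]| -> v <= l.
  move=> lt_i lt_v le_l; have [||x [y [xA yB Fxy]]] :=
    expand [set x | v <= b i x] [set x | b i.+1 x <= l]; 
    [by have := ltC i v; move: lt_v; set p := #|_|; set q := #|_|; lia | by []|].
  move: xA yB; rewrite !inE => le_v; apply: leq_trans.
  exact: leq_trans le_v (mono _ _ _ lt_i Fxy).
have same i l v : #|[set x | b i x < l]| < 2 * u -> n - 2 * u <= #|[set x | b i x <= v]| ->
    l <= v.
  move=> lt_l le_v; rewrite leqNgt; apply/negP => lt_vl.
  have := leq_card_imply (fun x (le_x : b i x <= v) => leq_ltn_trans le_x lt_vl); lia.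
have lo i := @exists_quantile n (2 * u) (b i) ltac:(lia) ltac:(lia).
have hi i := @exists_quantile n (n - 2 * u) (b i) ltac:(lia) ltac:(lia).
pose good i := exists t, [/\ i.+1 < H, n - 4 * u <= #|[set x | b i x == t]|
  & n - 4 * u <= #|[set x | b i.+1 x == t]|].
(* With [v] the high quantile of layer [i] and [l'] the low quantile of layer [i.+1], one has
   [l <= v <= l' <= w]. Equality throughout concentrates both layers on the value [l]. *)
have step i l w : i.+1 < H -> #|[set x | b i x < l]| < 2 * u ->
    n - 2 * u <= #|[set x | b i.+1 x <= w]| -> good i \/ l < w.
  move=> lt_i lt_l le_w; have [v [le_v lt_v]] := hi i; have [l' [le_l' lt_l']] := lo i.+1.
  have lv := same _ _ _ lt_l le_v; have vl' := next _ _ _ lt_i lt_v le_l'.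
  have l'w := same _ _ _ lt_l' le_w.
  case: (ltnP l w) => [lt_lw | le_wl]; [by right | left; exists l].
  have ev : v = l by lia. have el' : l' = l by lia. have ew : w = l by lia.
  move: le_v lt_l' le_w; rewrite ev el' ew => le_v lt_l' le_w.
  by split=> //; [have := eqC i l | have := eqC i.+1 l]; lia.
(* Without a good pair, the high quantile gains at least one on each of the disjoint pairs of layers
   [2 * j] and [(2 * j).+1]. At [j = m.-1] it would exceed every value below [m]. *)
have climb j : (2 * j).+1 < H -> (exists i, good i) \/
    forall t, n - 2 * u <= #|[set x | b (2 * j).+1 x <= t]| -> j < t.
  elim: j => [|j IHj] lt_j.
    have [l [_ lt_l]] := lo 0.
    have [[i gi] | no] := pselect (exists i, good i); first by left; exists i.
    right=> t /(step 0 l t lt_j lt_l)[g0 | ]; [by case: no; exists 0 | lia].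
  have [|g | IH] := IHj _; [lia | by left |].
  have [g | no] := pselect (exists i, good i); first by left.
  right=> t; have [l [le_l lt_l]] := lo (2 * j).+2; have [v [le_v lt_v]] := hi (2 * j).+1.
  have jv := IH v le_v; have vl : v <= l by apply: next lt_v le_l; lia.
  rewrite (_ : 2 * j.+1 = (2 * j).+2); last lia.
  move=> /(step _ l t _ lt_l)[|g | ]; [lia | by case: no; exists (2 * j).+2 | lia].
have [|[i [t ?]] | top] := climb m.-1 _; [lia | by exists i, t |].
have := top m.-1; rewrite (_ : [set x | _] = setT).
  by rewrite cardsT card_ord; lia.
by apply/setP => x; rewrite !inE; have := b_lt (2 * m.-1).+1 x; lia.
Qed.

(** In a copy, the block index does not decrease along edges of [F], so two consecutive layers have
    at least [n - 4 * u >= 60 * u] vertices each in one common block. There each part of the blow-up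
    receives at most [s] vertices of a layer, so some edge of [F] runs against [R]. *)
Lemma no_copy_in_lex (H n m K s u : nat) (F : rel 'I_n) (R : rel 'I_K)
    (e : rel ('I_H * 'I_n)) :
    0 < u -> 64 * u <= n -> 0 < m -> 2 * m <= H ->
    tournament R ->
    (forall A B : {set 'I_n}, 2 * u <= #|A| -> 2 * u <= #|B| ->
       exists x y, [/\ x \in A, y \in B & F x y]) ->
    (forall (A B : {set 'I_n}) (f g : 'I_n -> 'I_K),
       (forall a, #|[set x in A | f x == a]| <= s) ->
       (forall b, #|[set y in B | g y == b]| <= s) ->
       60 * u <= #|A| -> 60 * u <= #|B| ->
       exists x y, [/\ x \in A, y \in B, F x y & R (g y) (f x)]) ->
    (forall (i j : 'I_H) x y, j = i.+1 :> nat -> F x y -> e (i, x) (j, y)) ->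
  ~ contains_copy e (lex (fun i j : 'I_m => i < j) (lex R (fun i j : 'I_s => i < j))).
Proof.
move=> u0 u_le m0 m_le [R_irr R_tot] expand bad sub_e [phi [phi_inj phi_hom]].
have H0 : 0 < H by lia.
(* Layers become indexed by [nat]; indices from [H] on default to layer 0. *)
pose lay i : 'I_H := insubd (Ordinal H0) i.
have layE i : i < H -> lay i = i :> nat by move=> lt_i; rewrite /lay val_insubd lt_i.
have hom i x y : i.+1 < H -> F x y ->
    lex (fun i j : 'I_m => i < j) (lex R (fun i j : 'I_s => i < j))
      (phi (lay i, x)) (phi (lay i.+1, y)).
  by move=> lt_i Fxy; apply/phi_hom/sub_e => //; rewrite !layE // ltnW.
have [||i [t [lt_i leA leB]]] := @exists_concentrated_layers H n m u F
  (fun i x => (phi (lay i, x)).1) u0 _ m0 m_le expand (fun i x _ => ltn_ord _); first lia.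
  by move=> i x y lt_i /(hom i _ _ lt_i)/orP[/ltnW // | /andP[/eqP -> _]].
(* Once block and part are fixed, the third coordinate, one of [s] values, determines the vertex. *)
have fib j a : #|[set x in [set x | (phi (lay j, x)).1 == t :> nat]
    | (phi (lay j, x)).2.1 == a]| <= s.
  set X := finset _; rewrite -[s]card_ord -(@card_in_imset _ _ (fun x => (phi (lay j, x)).2.2) X).
    exact: max_card.
  move=> x y; rewrite !inE => /andP[/eqP xt /eqP xa] /andP[/eqP yt /eqP ya] eq2.
  suff /phi_inj[] : phi (lay j, x) = phi (lay j, y) by [].
  move: xt xa yt ya eq2; case: (phi (lay j, x)) => x1 [x2 x3].
  case: (phi (lay j, y)) => y1 [y2 y3] /=.
  by move=> xt -> yt -> ->; congr (_, _); apply: val_inj; rewrite /= xt yt.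
have [||x [y []]] := bad _ _ _ _ (fib i) (fib i.+1).
- by apply: leq_trans leA; lia.
- by apply: leq_trans leB; lia.
rewrite !inE => /eqP xt /eqP yt Fxy Rgf.
have := hom i x y lt_i Fxy; rewrite /lex xt yt ltnn /=.
move=> /andP[_ /orP[Rfg | /andP[/eqP eq_fg _]]].
  have neq : (phi (lay i, x)).2.1 != (phi (lay i.+1, y)).2.1.
    by apply: contraTneq Rfg => ->; rewrite R_irr.
  by move: Rfg; rewrite R_tot // Rgf.
by move: Rgf; rewrite eq_fg R_irr.
Qed.

(** * Existence and monotonicity of oriented Ramsey numbers *)

Lemma not_unavoidable (V W : finType) (e : rel V) (t : rel W) :
  tournament t -> ~ contains_copy e t -> ~ tournament_unavoidable e #|W|.
Proof.
move=> [t_irr t_tot] no_copy unav; apply: no_copy.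
have [|f [f_inj f_hom]] := unav (fun i j => t (enum_val i) (enum_val j)).
  by split=> [i | i j ij] /=; rewrite ?t_irr // t_tot // (inj_eq enum_val_inj).
by exists (enum_val \o f); split=> //; apply: inj_comp enum_val_inj f_inj.
Qed.

Lemma unavoidable_mono (V : finType) (e : rel V) (N N' : nat) :
  N <= N' -> tournament_unavoidable e N -> tournament_unavoidable e N'.
Proof.
move=> leN unav t [t_irr t_tot].
have w_inj : injective (widen_ord leN) by move=> i j /(congr1 val) /= eq_ij; apply: val_inj.
have [|f [f_inj f_hom]] := unav (fun i j => t (widen_ord leN i) (widen_ord leN j)).
  by split=> [i | i j ij] /=; rewrite ?t_irr // t_tot // (inj_eq w_inj).
by exists (widen_ord leN \o f); split=> //; apply: inj_comp w_inj f_inj.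
Qed.

(** Any vertex of [A] has at least [2 ^ k] out-neighbours or in-neighbours in a set of size
    [2 ^ k.+1]; it is put before or after the sequence found among them. *)
Lemma exists_transitive_subtournament (T : finType) (t : rel T) (k : nat) (A : {set T}) :
    tournament t -> 2 ^ k <= #|A| ->
  exists s : seq T, [/\ size s = k, {subset s <= A} & pairwise t s].
Proof.
move=> [t_irr t_tot]; elim: k A => [|k IHk] A leA; first by exists [::].
have /card_gt0P[x xA] : 0 < #|A| by apply: leq_trans leA; rewrite expn_gt0.
have : #|A| <= 1 + (#|[set y in A | t x y]| + #|[set y in A | t y x]|).
  rewrite -(cards1 x); apply: leq_trans (leq_add (leqnn _) (leq_card_setU _ _)).
  apply: leq_trans (leq_card_setU _ _); apply/subset_leq_card/subsetP => y yA.
  by rewrite !inE yA /=; case: eqVneq => //= /t_tot ->; case: (t x y).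
move: leA; rewrite expnS => leA leS.
case: (leqP (2 ^ k) #|[set y in A | t x y]|) => [/IHk[s [ss sA ps]] | lt_out].
  exists (x :: s); split; first by rewrite /= ss.
    by move=> y; rewrite inE => /predU1P[-> // | /sA]; rewrite inE => /andP[].
  by rewrite /= ps andbT; apply/allP => y /sA; rewrite inE => /andP[].
have /IHk[s [ss sA ps]] : 2 ^ k <= #|[set y in A | t y x]| by lia.
exists (rcons s x); split; first by rewrite size_rcons ss.
  by move=> y; rewrite mem_rcons inE => /predU1P[-> // | /sA]; rewrite inE => /andP[].
by rewrite pairwise_rcons ps andbT; apply/allP => y /sA; rewrite inE => /andP[].
Qed.

(** The ranking [rk] embeds the digraph in a transitive tournament on [k] vertices, which every
    tournament on [2 ^ k] vertices contains; the least unavoidable size then exists. *)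
Lemma exists_oriented_ramsey (V : finType) (e : rel V) (rk : V -> nat) :
    injective rk -> (forall x y, e x y -> rk x < rk y) ->
  exists r, oriented_ramsey e r.
Proof.
move=> rk_inj rk_hom; pose k := (\max_x rk x).+1.
have ex_r : exists N, `[< tournament_unavoidable e N >].
  exists (2 ^ k); apply/asboolP => t tt.
  have [|s [ss _ /(pairwiseP (Ordinal (expn_gt0 2 k))) ps]] :=
    @exists_transitive_subtournament _ t k setT tt; first by rewrite cardsT card_ord.
  have rk_lt x : rk x < size s by rewrite ss ltnS leq_bigmax.
  pose f x := nth (Ordinal (expn_gt0 2 k)) s (rk x).
  have f_hom x y : rk x < rk y -> t (f x) (f y) by move=> lt_xy; apply: ps => //; rewrite inE.
  exists f; split=> [x y fxy | x y /rk_hom/f_hom //].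
  by apply: rk_inj; case: (ltngtP (rk x) (rk y)) => // /f_hom; rewrite fxy tt.1.
case: (ex_minnP ex_r) => r /asboolP unav min_r; exists r; split=> // N /asboolP.
exact: min_r.
Qed.

(** * The graded digraph *)

Lemma exists_superset_card (T : finType) (A : {set T}) k :
  #|A| <= k <= #|T| -> exists2 B : {set T}, A \subset B & #|B| = k.
Proof.
move=> /andP[leA leT]; have [|C sC cC] := @exists_subset_card _ (~: A) (k - #|A|).
  by have := cardsC A; lia.
exists (A :|: C); first exact: subsetUl.
by rewrite cardsU (disjoint_setI0 _) ?cards0 ?cC; [lia | rewrite disjoint_sym disjoints_subset].
Qed.

Lemma card_ord_eq (H k : nat) : #|[set j : 'I_H | j == k :> nat]| <= 1.
Proof.
apply/card_le1_eqP => i j; rewrite !inE => /eqP ik /eqP jk.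
by apply: val_inj; rewrite /= ik jk.
Qed.

(* One vertex of the first layer receives additional out-neighbours in order to
   make the maximum degree exactly [Delta]. *)
Lemma exists_layered_graph (H n d Delta : nat) (F : rel 'I_n) :
    2 <= H -> 2 * d + 1 <= Delta -> Delta <= n ->
    (forall x, #|[set y | F x y]| <= d) ->
    (forall y, #|[set x | F x y]| <= d) ->
  exists e : rel ('I_H * 'I_n),
    [/\ max_degree e = Delta,
        forall v w, e v w -> w.1 = v.1.+1 :> nat
      & forall (i j : 'I_H) x y, j = i.+1 :> nat -> F x y -> e (i, x) (j, y)].
Proof.
move=> H2 d_le Delta_le outF inF.
have n0 : 0 < n by lia.
have H0 : 0 < H by lia.
pose x0 : 'I_n := Ordinal n0; pose i0 : 'I_H := Ordinal H0; pose i1 : 'I_H := Ordinal H2.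
have [|Y0 sY0 cY0] := @exists_superset_card _ [set y | F x0 y] Delta.
  by rewrite card_ord Delta_le andbT; apply: leq_trans (outF x0) _; lia.
pose e (v w : 'I_H * 'I_n) := (w.1 == v.1.+1 :> nat) &&
  (F v.2 w.2 || (v == (i0, x0)) && (w.2 \in Y0)).
have deg0 : [set w | underlying e (i0, x0) w] = setX [set i1] Y0.
  apply/setP => -[j y].
  have -> : ((j, y) \in setX [set i1] Y0) = e (i0, x0) (j, y).
    rewrite !inE /e eqxx /= -val_eqE /=; congr andb.
    by apply/idP/orP => [-> | [Fy | //]]; [right | apply: (subsetP sY0); rewrite inE].
  rewrite inE /underlying [e (j, y) _]/e /= orbF andbC.
  case: (boolP (e _ _)) => //= /andP[/eqP j1 _].
  by apply/negP => /eqP[ij _]; move: j1; rewrite -ij.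
have leD v : v != (i0, x0) -> #|[set w | underlying e v w]| <= Delta.
  (* At most [d] neighbours lie above and [d + 1] below, the extra one being [x0]. For [i = 0] the
     set [down] sits in layer 0 itself, which only weakens the bound. *)
  case: v => i x nv; pose up := setX [set j : 'I_H | j == i.+1 :> nat] [set y | F x y].
  pose down := setX [set j : 'I_H | j == i.-1 :> nat] (x0 |: [set y | F y x]).
  apply: (@leq_trans #|up :|: down|).
    apply/subset_leq_card/subsetP => -[j y]; rewrite !inE /underlying /e /=.
    move=> /andP[_ /orP[] /andP[ij]]; rewrite ?(negPf nv) ?orbF.
      by move=> ->; rewrite ij.
    rewrite (eqP ij) /= eqxx => /orP[-> | /andP[/eqP[_ ->] _]]; by rewrite ?eqxx ?orbT.
  apply: leq_trans (leq_card_setU _ _) _; rewrite !cardsX.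
  apply: leq_trans d_le; rewrite mul2n -addnn -addnA; apply: leq_add.
    by rewrite -[d]mul1n; apply: leq_mul => //; apply: card_ord_eq.
  rewrite -[d + 1]mul1n; apply: leq_mul; first exact: card_ord_eq.
  by rewrite cardsU1 addnC leq_add ?inF //; case: (_ \notin _).
exists e; split.
- apply/eqP; rewrite eqn_leq; apply/andP; split.
    apply/bigmax_leqP => v _; case: (eqVneq v (i0, x0)) => [-> | /leD //].
    by rewrite deg0 cardsX cards1 mul1n cY0.
  by apply: leq_trans (leq_bigmax (i0, x0)); rewrite deg0 cardsX cards1 mul1n cY0.
- by move=> v w /andP[/eqP].
- by move=> i j x y ij Fxy; rewrite /e /= ij eqxx Fxy.
Qed.

Lemma graded_layers (H n : nat) (e : rel ('I_H * 'I_n)) :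
    0 < n -> (forall v w, e v w -> w.1 = v.1.+1 :> nat) ->
  graded_partition e (fun i : 'I_H => setX [set i] setT).
Proof.
move=> n0 graded; have mem_layer (i : 'I_H) : (i, Ordinal n0) \in setX [set i] setT by rewrite !inE eqxx.
split.
- move=> i j eq_ij; have := mem_layer i; rewrite eq_ij !inE andbT => /eqP //.
- apply/and3P; split.
  + rewrite eqEsubset subsetT; apply/subsetP => -[i x] _; apply/bigcupP.
    by exists (setX [set i] setT); [apply: imset_f | rewrite !inE eqxx].
  + apply/trivIsetP => _ _ /imsetP[i _ ->] /imsetP[j _ ->] neq.
    rewrite -setI_eq0; apply/eqP/setP => -[k x]; rewrite !inE !andbT.
    by apply/negP => /andP[/eqP ki /eqP kj]; rewrite -ki -kj eqxx in neq.
  + by apply/imsetP => -[i _ eq0]; have := mem_layer i; rewrite -eq0 inE.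
- move=> v w /graded vw; exists v.1, w.1; split=> //.
    by case: v {vw} => i x; rewrite !inE eqxx.
  by case: w {vw} => i x; rewrite !inE eqxx.
Qed.

(** * Numerical estimates and choice of parameters *)

Lemma linear_leq_exp2 (g : nat) : 20 <= g -> 24 * 1024 * g <= 2 ^ g.
Proof.
elim: g => // g IHg ge20; case: (ltnP 19 g) => [/IHg | g_le].
  by rewrite expnS; move: (2 ^ g) => t; lia.
have -> : g = 19 by lia.
lia.
Qed.

(** With [h = 2 * g], one factor [2 ^ g] of [2 ^ h] absorbs the loss [n <= 4096 * g * s] and the
    rounding of [H %/ 2]; the other is the exponential gain. *)
Lemma blowup_size (H n g u s : nat) :
    2 <= H -> 20 <= g -> n <= 128 * u -> 0 < s -> u <= 32 * g * s ->
  2 ^ g.+1 * (H * n) <= (H %/ 2) * (2 ^ (2 * g) * s).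
Proof.
move=> H2 g20 n_le s0 u_le.
have leH : H <= 3 * (H %/ 2) by lia.
have len : n <= 4096 * g * s by lia.
apply: (@leq_trans (2 ^ g.+1 * (3 * (H %/ 2) * (4096 * g * s)))).
  by rewrite leq_mul2l leq_mul ?orbT.
have -> : 2 ^ g.+1 * (3 * (H %/ 2) * (4096 * g * s))
    = H %/ 2 * (2 ^ g * (24 * 1024 * g) * s) by rewrite expnS; lia.
rewrite mul2n -addnn expnD leq_mul2l; apply/orP; right.
by rewrite leq_mul2r leq_mul2l linear_leq_exp2 ?orbT.
Qed.

Local Open Scope ring_scope.

(** By convexity [(1 + x) ^+ B] lies below its chord on the unit interval; [x = 2 ^- B] makes the
    chord at most 2. *)
Lemma exists_root_bound (R : realType) (B : nat) : exists c : R, 1 < c /\ c ^+ B <= 2.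
Proof.
pose x : R := (2 ^+ B)^-1; have x0 : 0 < x by rewrite invr_gt0 exprn_gt0.
have x1 : x <= 1 by rewrite invf_le1 ?exprn_gt0 // exprn_ege1 // ler1n.
exists (1 + x); split; first by rewrite ltrDl.
have bern k : (1 + x) ^+ k <= 1 + (2 ^+ k - 1) * x.
  elim: k => [|k IHk]; first by rewrite !expr0 subrr mul0r addr0.
  have k1 : 1 <= 2 ^+ k :> R by rewrite exprn_ege1 // ler1n.
  rewrite exprS; apply: le_trans (ler_wpM2l _ IHk) _; first by rewrite addr_ge0 // ltW.
  have : 0 <= (2 ^+ k - 1) * x * (1 - x) by rewrite !mulr_ge0 ?subr_ge0 // ltW.
  by rewrite exprS; lra.
apply: le_trans (bern B) _; rewrite mulrBl mulfV ?lt0r_neq0 ?exprn_gt0 // mul1r.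
by lra.
Qed.

Theorem theorem1p5 (R : realType) :
  exists (c : R) (Delta0 : nat), 1 < c /\
    forall Delta n H : nat,
      (Delta0 <= Delta)%N -> (Delta <= n)%N -> (2 <= H)%N ->
      exists (V : finType) (e : rel V) (P : 'I_H -> {set V}) (r : nat),
        [/\ max_degree e = Delta,
            graded_partition e P,
            forall i : 'I_H, (#|P i| <= n)%N,
            oriented_ramsey e r
          & c ^+ Delta * H%:R * n%:R < r%:R /\
            c ^+ Delta * #|V|%:R <= c ^+ Delta * H%:R * n%:R].
Proof.
(* [B] is twice the [2 * 128 * 1024 * 2] of the degree bound, so [g * B <= Delta] also leaves room
   for the extra 1. Keeping it a variable prevents its unfolding. *)
have [B eB] : exists B, B = (1024 * 1024)%N by exists (1024 * 1024)%N.
have [c [c1 cB]] := exists_root_bound R B.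
exists c, (20 * B)%N; split=> // Delta n H Delta_ge n_ge H2.
have B0 : (0 < B)%N by lia.
(* The random tournament has [2 ^ (2 * g)] vertices, and [s] is the largest part size that
   [exists_core] allows. *)
pose g := (Delta %/ B)%N; pose u := (n %/ 64)%N; pose s := (u %/ (8 * (2 * g)))%N.
have g20 : (20 <= g)%N by rewrite leq_divRL.
have gB_le : (g * B <= Delta)%N by apply: leq_trunc_div.
have lt_gB : (Delta < g.+1 * B)%N by rewrite ltn_ceil.
have u_ge : (8 * (2 * g) <= u)%N by rewrite leq_divRL //; lia.
have s0 : (0 < s)%N by rewrite divn_gt0 //; lia.
have s_le : (s * (8 * (2 * g)) <= u)%N by apply: leq_trunc_div.
have lt_s : (u < s.+1 * (8 * (2 * g)))%N by rewrite ltn_ceil //; lia.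
have u_le : (64 * u <= n)%N by rewrite mulnC leq_trunc_div.
have n_lt : (n < u.+1 * 64)%N by rewrite ltn_ceil.
have h0 : (0 < 2 * g)%N by lia.
have u0 : (0 < u)%N by lia.
have n_le : (n <= 128 * u)%N by lia.
have [F [T [tT outF inF expand bad]]] := exists_core h0 u0 n_le s_le.
have d_le : (2 * (128 * (1024 * (2 * g))) + 1 <= Delta)%N by lia.
have [e [max_e graded_e sub_e]] := exists_layered_graph H2 d_le n_ge outF inF.
(* The vertices are ranked layer by layer. *)
have [||r [unav_r min_r]] := @exists_oriented_ramsey _ e (fun v => v.1 * n + v.2)%N.
- move=> [i x] [j y] /= eq_v.
  have eq_x : x = y :> nat.
    by have := congr1 (modn^~ n) eq_v; rewrite !modnMDl !modn_small.
  have eq_i : i = j :> nat.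
    by move: eq_v; rewrite eq_x => /addIn/eqP; rewrite eqn_pmul2r; [move/eqP | lia].
  by congr (_, _); apply: val_inj.
- move=> [i x] [j y] /graded_e /= ->; have := ltn_ord x; rewrite mulSn; lia.
exists ('I_H * 'I_n)%type, e, (fun i => setX [set i] setT), r; split=> //.
- by apply: graded_layers => //; lia.
- by move=> i; rewrite cardsX cards1 mul1n cardsT card_ord.
have lt_r : (2 ^ g.+1 * (H * n) < r)%N.
  apply: (@leq_ltn_trans ((H %/ 2) * (2 ^ (2 * g) * s))%N).
    by apply: (@blowup_size H n g u s) => //; lia.
  rewrite ltnNge; apply/negP => le_r.
  have := @not_unavoidable _ _ e _ (tournament_lex (tournament_ltn (H %/ 2))
    (tournament_lex tT (tournament_ltn s))).
  rewrite !card_prod !card_ord; apply; last exact: unavoidable_mono le_r unav_r.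
  by apply: (no_copy_in_lex _ u_le _ _ tT expand bad sub_e); lia.
rewrite card_prod !card_ord natrM mulrA; split=> //.
apply: le_lt_trans (_ : (2 ^ g.+1 * (H * n))%:R < _); last by rewrite ltr_nat.
rewrite !natrM natrX -mulrA ler_wpM2r ?mulr_ge0 //.
have c0 : 0 <= c by apply: le_trans (ltW c1).
(* Here [Delta < B * g.+1] and [c ^+ B <= 2] give [c ^+ Delta <= 2 ^ g.+1]. *)
apply: (@le_trans _ _ (c ^+ (B * g.+1))).
  by rewrite ler_eXn2l //; lia.
by rewrite exprM; apply: lerXn2r; rewrite ?nnegrE ?exprn_ge0.
Qed.
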